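(* Let $\mathscr C$ be a proper minor-closed class of graphs containing at least one graph with an edge, and let $d=\mathrm{mad}(\mathscr C)$. Then for every integer $p\ge2$, every graph $G\in\mathscr C$ with \[ \mathrm{girth}(G)>\bigl(4\log_2 d+2\log_2(\min\{d,576\})+3\bigr)(p-1) \] is $p$-path degenerate.
   Context: Graphs are finite and simple; the girth is the length of a shortest cycle ($+\infty$ for forests). A minor-closed class is proper if it does not contain all finite graphs. The maximum average degree $\mathrm{mad}(G)$ of a graph is the maximum of $2|E(H)|/|V(H)|$ over nonempty subgraphs $H$ of $G$, and $\mathrm{mad}(\mathscr C)=\sup\{\mathrm{mad}(G):G\in\mathscr C\}$. A strict ear of a graph $G$ is a path of $G$ whose internal vertices all have degree $2$ in $G$ and whose two endpoints are distinct. For an integer $p\ge1$, a $p$-reduction of $G$ is the deletion of either an isolated vertex, or a vertex of degree $1$, or the internal vertices of a strict ear of $G$ of length at least $p$. A graph is $p$-path degenerate if it can be reduced to the empty graph by a sequence of $p$-reductions. *)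

(* Defs.v *)
From mathcomp Require Import all_boot.
From Stdlib Require Import Reals.

Set Implicit Arguments.
Unset Strict Implicit.
Unset Printing Implicit Defensive.

Record sgraph := SGraph {
  nv : nat;
  adj : rel 'I_nv;
  adj_sym : symmetric adj;
  adj_irr : irreflexive adj }.
Arguments adj s : clear implicits.

Definition gclass := sgraph -> Prop.

Definition connected_in (G : sgraph) (B : {set 'I_(nv G)}) : Prop :=
  forall x y, x \in B -> y \in B ->
    connect (fun a b => [&& a \in B, b \in B & adj G a b]) x y.

(* H is a minor of G: there is a minor model, i.e. pairwise disjoint nonempty
   connected branch sets B v (v vertex of H) such that every edge uv of H is
   realised by an edge of G between B u and B v.  (This is up to isomorphism.) *)
Definition minor (H G : sgraph) : Prop :=
  exists B : 'I_(nv H) -> {set 'I_(nv G)},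
    [/\ forall v, B v != set0,
        forall u v, u != v -> [disjoint B u & B v],
        forall v, connected_in (B v)
      & forall u v, adj H u v ->
          exists x y, [/\ x \in B u, y \in B v & adj G x y]].

Definition minor_closed (C : gclass) : Prop :=
  forall G H, C G -> minor H G -> C H.

Definition proper_class (C : gclass) : Prop := exists G, ~ C G.

Definition has_edge (G : sgraph) : Prop := exists u v, adj G u v.

Definition edges_in (G : sgraph) (S : {set 'I_(nv G)}) : {set {set 'I_(nv G)}} :=
  [set [set x.1; x.2] | x in [set x : 'I_(nv G) * 'I_(nv G) |
                                [&& x.1 \in S, x.2 \in S & adj G x.1 x.2]]].

(* mad G = max over nonempty vertex sets S of 2|E(G[S])|/|S| (0 for the
   graph with no vertex). *)
Definition mad (G : sgraph) : R :=
  \big[Rmax/0%R]_(S : {set 'I_(nv G)} | S != set0)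
     (2 * INR #|edges_in S| / INR #|S|)%R.

Definition is_mad_class (C : gclass) (d : R) : Prop :=
  is_lub (fun r => exists G, C G /\ r = mad G) d.

(* Cycles: sequences of >= 3 distinct vertices, cyclically consecutive ones
   adjacent.  girth_gt G x  <->  girth(G) > x, with girth = +oo for forests. *)
Definition is_cycle (G : sgraph) (s : seq 'I_(nv G)) : bool :=
  [&& 3 <= size s, uniq s & cycle (adj G) s].

Definition girth_gt (G : sgraph) (x : R) : Prop :=
  forall s, @is_cycle G s -> (x < INR (size s))%R.

Definition log2 (x : R) : R := (ln x / ln 2)%R.

(* Current graph = induced subgraph G[S]. *)
Definition deg_in (G : sgraph) (S : {set 'I_(nv G)}) (x : 'I_(nv G)) : nat :=
  #|[set y in S | adj G x y]|.

(* A strict ear of G[S]: a path x, mid..., y (distinct vertices, consecutive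
   adjacent) in S, whose internal vertices mid have degree 2 in G[S]; its
   endpoints are distinct (by uniqueness); its length is size mid + 1. *)
Definition strict_ear (G : sgraph) (S : {set 'I_(nv G)})
    (x : 'I_(nv G)) (mid : seq 'I_(nv G)) (y : 'I_(nv G)) : bool :=
  [&& all (fun z => z \in S) (x :: rcons mid y),
      uniq (x :: rcons mid y),
      path (adj G) x (rcons mid y)
    & all (fun z => deg_in S z == 2) mid].

Definition p_reduction (G : sgraph) (p : nat) (S S' : {set 'I_(nv G)}) : Prop :=
  (exists v, [/\ v \in S, deg_in S v <= 1 & S' = S :\ v])
  \/ (exists x mid y, [/\ strict_ear S x mid y, p <= size mid + 1
                        & S' = S :\: [set z in mid]]).

Inductive reducible (G : sgraph) (p : nat) : {set 'I_(nv G)} -> Prop :=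
  | reducible_empty : reducible p set0
  | reducible_step S S' : p_reduction p S S' -> reducible p S' -> reducible p S.

Definition path_degenerate (p : nat) (G : sgraph) : Prop :=
  reducible p [set: 'I_(nv G)].

(* Main.v *)
Require Import Defs.
From mathcomp Require Import all_boot zify.

Set Implicit Arguments.
Unset Strict Implicit.
Unset Printing Implicit Defensive.

(** If some induced subgraph [G[S]] admits no reduction, it has minimum degree
at least 2 and all its ears are shorter than [p].  Suppressing its vertices of
degree 2 one after the other, while recording lengths as edge weights, yields a
simple minor [H] of minimum degree at least 3 whose girth exceeds
[g := 4 log2 d + 2 log2 (min d 576) + 3], since a cycle of length [l] in [H] has
weight at most [l (p - 1)].

Let [k] be the natural number with [4k + 2 <= g < 4k + 6].  If [k <= 1] then
[d < 3 <= mad H].  Otherwise fix a set [X] of centres and contract its Voronoi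
cells of radius [k], dropping the uncovered vertices.  As [H] has no cycle of
length at most [4k + 2], each cell induces a tree and two cells are joined by at
most one edge, so distinct edges between cells remain distinct.  Balls of radius [k]
have at least [3 (2^k - 1) + 1] vertices, so about [n / 2^k] random centres
leave few vertices uncovered, and the contracted graph has average degree at
least [2 + 15 * 2^k / 32], which exceeds [d]. *)

(** * Paths in graphs of large girth *)

(* [lia] does not identify the two carriers [Equality.sort T] and [Finite.sort T]. *)
Ltac tlia :=
  try change (Equality.sort (fintype_Finite__to__eqtype_Equality ?X))
    with (Finite.sort X) in *; lia.

Section Graph.

Variables (T : finType) (e : rel T).
Hypotheses (e_sym : symmetric e) (e_irr : irreflexive e).

Definition upath x p := path e x p && uniq (x :: p).

Definition nbr x : {set T} := [set y | e x y].

(* Every cycle has more than [m] vertices. *)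
Definition girth_above m :=
  forall x p, upath x p -> e (last x p) x -> 1 < size p -> m <= size p.

Lemma upath_cons x y p : upath x (y :: p) -> upath y p.
Proof. by case/andP=> /= /andP[_ pp] /andP[_ up]; rewrite /upath pp. Qed.

Lemma upath_rcons x p y :
  upath x (rcons p y) = [&& upath x p, e (last x p) y & y \notin x :: p].
Proof.
rewrite /upath rcons_path -rcons_cons rcons_uniq.
by case: (path e x p); case: (e _ _); case: (y \notin _); case: (uniq _).
Qed.

Lemma upath_catl x p q : upath x (p ++ q) -> upath x p.
Proof.
by case/andP; rewrite -cat_cons cat_uniq cat_path /upath => /andP[-> _] /andP[->].
Qed.

Lemma upath_catr x p q : upath x (p ++ q) -> upath (last x p) q.
Proof.
elim: p x => [|y p IHp] x //= /upath_cons; exact: IHp.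
Qed.

Lemma path_rev x p : path e (last x p) (rev (belast x p)) = path e x p.
Proof. by rewrite rev_path; apply: eq_path => y z; rewrite e_sym. Qed.

(* Otherwise the parts of the two paths up to their first divergence and
   re-encounter close up to a cycle of length at most [m]. *)
Lemma upath_inj m x p q : girth_above m ->
  upath x p -> upath x q -> last x p = last x q -> size p + size q <= m ->
  p = q.
Proof.
move=> gm; elim: p x q => [|y p IHp] x [|z q] //=.
- move=> _ /andP[_ /= /andP[xq _]] xl; move: xq.
  by rewrite xl -[last z q]/(last z q) mem_last.
- move=> /andP[_ /= /andP[xp _]] _ xl; move: xp.
  by rewrite -xl mem_last.
move=> Up Uq lpq szm.
have [eyz|nyz] := eqVneq y z.
  rewrite -eyz in Uq lpq *; rewrite (IHp y q) //; try exact: upath_cons; try lia.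
  exact: upath_cons Up.
  exact: upath_cons Uq.
have ny : y = head x (y :: p) by [].
have nz : z = head x (z :: q) by [].
have h : has (mem (z :: q)) (y :: p).
  by apply/hasP; exists (last y p); [exact: mem_last | rewrite lpq; exact: mem_last].
have {}szm : size (y :: p) + size (z :: q) <= m by [].
move: (y :: p) (z :: q) Up Uq szm h ny nz => P Q Up Uq szm h ny nz {IHp lpq p q}.
(* [a] is the first vertex of [P] that lies on [Q], so [p1] avoids [Q]; out along [p1] and back
   along [q1] is the cycle. *)
case: (split_find h) Up szm ny => a p1 p2 aQ np1 Up szm ny.
have {}aQ : a \in Q by [].
case/splitPr: aQ Uq szm nz np1 => q1 q2 Uq szm nz np1 {h P Q}.
have {Up} Up := upath_catl Up.
have {Uq} Uq : upath x (rcons q1 a) by apply: (upath_catl (q := q2)); rewrite cat_rcons.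
have [/andP[Pp up] /andP[Pq uq]] := (Up, Uq).
have U : upath x (rcons p1 a ++ rev q1).
  rewrite /upath cat_path Pp /= last_rcons.
  have -> : path e a (rev q1).
    move: Pq; rewrite -path_rev last_rcons belast_rcons rev_cons rcons_path.
    by case/andP.
  move: up uq => /= /andP[xp up] /andP[xq uq].
  rewrite mem_cat negb_or xp mem_rev cat_uniq up rev_uniq.
  move: xq uq; rewrite mem_rcons inE negb_or rcons_uniq => /andP[_ ->] /andP[aq ->].
  rewrite /= andbT; apply/hasPn => b; rewrite mem_rev => bq /=.
  rewrite mem_rcons inE negb_or; apply/andP; split.
    by apply: contraNneq aq => <-.
  apply: contraNN np1 => bp; apply/hasP; exists b => //=.
  by rewrite mem_cat bq.
have := gm _ _ U; rewrite !size_cat /= in szm *; rewrite size_rcons size_rev in szm *.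
(* If [p1] and [q1] are both empty, both paths start with [a], against [y != z]. Otherwise the cycle
   is too short, as [a] is counted on each path. *)
move=> H; have {}H := H _ _; case: (posnP (size p1 + size q1)) => s0.
  case: p1 q1 s0 ny nz nyz {np1 Up Uq Pp up Pq uq U szm H} => [|//] [|//] _ /= -> ->.
  by rewrite eqxx.
exfalso; have {}H : m <= (size p1).+1 + size q1; last first.
  tlia.
apply: H; last by tlia.
rewrite last_cat last_rcons e_sym.
case: q1 Pq {nz np1 Uq uq U szm s0} => [|b q1] /=.
  by rewrite andbT => ?.
by case/andP=> eb _; rewrite rev_cons last_rcons.
Qed.

(** Ends of paths of length exactly [i]. When [girth_above m] holds and [2 * i <= m], these are the
    vertices at distance [i], as short paths are determined by their ends. *)
Definition layer i x : {set T} :=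
  [set y | [exists p : i.-tuple T, upath x p && (last x p == y)]].

Lemma layerP i x y :
  reflect (exists p, [/\ upath x p, size p = i & last x p = y]) (y \in layer i x).
Proof.
rewrite inE; apply: (iffP existsP) => [[p /andP[up /eqP lp]]|[p [up sp lp]]].
  by exists p; rewrite size_tuple.
by exists (tcast sp (in_tuple p)); rewrite val_tcast /= up lp eqxx.
Qed.

(** Both bounds estimate the number of related pairs, summed first over [A], then over [B]. *)
Lemma double_count (A B : {set T}) (r : rel T) a :
  (forall y, y \in A -> a <= #|[set z in B | r y z]|) ->
  (forall z, z \in B -> #|[set y in A | r y z]| <= 1) ->
  a * #|A| <= #|B|.
Proof.
move=> lA uB.
have cnt (P : pred T) (F : {set T}) : \sum_(z in F | P z) 1 = #|[set z in F | P z]|.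
  by rewrite sum1dep_card.
apply: (@leq_trans (\sum_(y in A) \sum_(z in B | r y z) 1)).
  by rewrite mulnC -sum_nat_const; apply: leq_sum => y yA; rewrite cnt lA.
rewrite (exchange_big_dep (mem B)) /=; last by move=> y z _ /andP[].
rewrite -sum1_card; apply: leq_sum => z zB.
rewrite (eq_bigl (fun y => (y \in A) && r y z)) ?cnt ?uB // => y.
by rewrite zB.
Qed.

Lemma layer1 x : layer 1 x = nbr x.
Proof.
apply/setP=> y; rewrite [RHS]inE; apply/layerP/idP.
  by case=> -[|z [|w p]] [] // /andP[/= /andP[xz _] _] _ <-.
move=> xy; exists [:: y]; split=> //; rewrite /upath /= xy inE /= andbT.
by apply: contraTneq xy => ->; rewrite e_irr.
Qed.

(** A path to [y] in layer [i] extends along every neighbour of [y] except its predecessor, hence in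
    at least two ways. Uniqueness of short paths makes a vertex of layer [i.+1] determine its
    neighbour in layer [i]. *)
Lemma layer_grow m i x : (forall y z, e y z -> 2 < #|nbr z|) ->
  girth_above m -> 0 < i -> 2 * i.+1 <= m ->
  2 * #|layer i x| <= #|layer i.+1 x|.
Proof.
move=> deg gm i0 im; apply: (@double_count _ _ e) => [y /layerP[p [up sp lp]]|z].
  case/lastP: p => [|p w] in up sp lp *; first by rewrite -sp in i0.
  rewrite last_rcons in lp; rewrite {w}lp in up sp *.
  have := up; rewrite upath_rcons => /and3P[Up ey yp].
  suff sub : nbr y \subset last x p |: [set z in layer i.+1 x | e y z].
    have := leq_trans (deg _ _ ey) (subset_leq_card sub).
    by rewrite cardsU1; case: (_ \notin _) => /=; lia.
  apply/subsetP=> z; rewrite !inE => yz.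
  have [zp|zp] := boolP (z \in x :: rcons p y); last first.
    apply/orP; right; rewrite yz andbT.
    suff: z \in layer i.+1 x by rewrite inE.
    apply/layerP; exists (rcons (rcons p y) z).
    by rewrite upath_rcons up !last_rcons yz zp size_rcons sp.
  rewrite -rcons_cons mem_rcons inE in zp.
  have nzy : z != y by apply: contraTneq yz => ->; rewrite e_irr.
  rewrite (negPf nzy) /= in zp.
  (* A neighbour [z] of [y] on the path is joined to [y] by an edge and by a final segment of the
     path; these coincide, so [z] is the predecessor. *)
  case/splitPl: zp up sp {Up ey yp} => p1 p2 lz up sp.
  rewrite rcons_cat in up sp; have := upath_catr up; rewrite lz => u2.
  have u1 : upath z [:: y] by rewrite /upath /= e_sym yz inE nzy.
  have := upath_inj gm u1 u2; rewrite last_rcons /= => /(_ erefl).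
  rewrite size_cat in sp => E; case: p2 {u2 up} sp E => [|b p2] sp.
    by rewrite cats0 lz eqxx.
  move=> /= E; have {E} : [:: y] = b :: rcons p2 y by apply: E; move: sp => /=; tlia.
  by case: p2 {sp}.
case/layerP=> p [up sp lp]; apply/card_le1_eqP => y y'.
rewrite inE => /andP[yA yz]; rewrite inE => /andP[yA' yz'].
have pre w : w \in layer i x -> e w z -> exists2 q, p = rcons q z & last x q = w.
  case/layerP=> q [uq sq lq] wz; exists q => //; rewrite -lq in wz.
  have [zq|zq] := boolP (z \in x :: q); last first.
    apply: (upath_inj gm up); rewrite ?upath_rcons ?uq ?wz ?zq // ?last_rcons //.
    by rewrite size_rcons sq sp; tlia.
  (* Otherwise [p] would be an initial part of the path to [w], which is shorter than [p]. *)
  exfalso; case/splitPl: zq sq uq wz lq => q1 q2 lz; rewrite size_cat => sq uq _ _.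
  have E : p = q1 by apply: (upath_inj gm up (upath_catl uq)); rewrite ?lp ?lz //; tlia.
  by move: sp sq; rewrite E; tlia.
have [q1 E1 <-] := pre y yA yz; have [q2 E2 <-] := pre y' yA' yz'.
by move: E1; rewrite E2 => /rcons_inj[->].
Qed.

Fixpoint ball i x : {set T} :=
  if i is j.+1 then ball j x :|: \bigcup_(y in nbr x) ball j y else [set x].

Lemma ball_upath i x y : y \in ball i x ->
  exists p, [/\ upath x p, size p <= i & last x p = y].
Proof.
suff: y \in ball i x -> exists p, [/\ path e x p, size p <= i & last x p = y].
  move=> H /H[p [xp sp <-]]; case/shortenP: xp => q xq uq qp; exists q.
  split; rewrite /upath ?xq //; apply: leq_trans sp.
  by apply: uniq_leq_size => //; case/andP: uq.
elim: i x => [|i IHi] x /=; first by rewrite inE => /eqP->; exists [::].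
rewrite inE => /orP[/IHi[p [xp sp lp]]|/bigcupP[z]]; first by exists p; split=> //; lia.
by rewrite inE => xz /IHi[p [xp sp lp]]; exists (z :: p); rewrite /= xz.
Qed.

Lemma layer_ball i x : layer i x \subset ball i x.
Proof.
apply/subsetP=> y /layerP[p [/andP[xp _] sp <-]] {y}.
elim: i x p xp sp => [|i IHi] x [|y p] //=; first by rewrite inE.
case/andP=> xy yp [sp]; rewrite inE; apply/orP; right.
by apply/bigcupP; exists y; rewrite ?inE ?IHi.
Qed.

(** With [D] the degree of [x], the bound is [1 + D (2^k - 1)] without subtraction: layer [j + 1]
    has at least [D 2^j] vertices and is disjoint from the ball of radius [j]. *)
Lemma ball_card m k x : (forall y z, e y z -> 2 < #|nbr z|) ->
  girth_above m -> 2 * k <= m -> #|nbr x| * 2 ^ k + 1 <= #|ball k x| + #|nbr x|.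
Proof.
move=> deg gm; elim: k => [|k IHk] km /=; first by rewrite cards1 expn0; lia.
have lay j : 2 * j.+1 <= m -> #|nbr x| * 2 ^ j <= #|layer j.+1 x|.
  elim: j => [|j IHj] jm; first by rewrite layer1 expn0 muln1.
  rewrite expnS mulnCA; apply: leq_trans (layer_grow (i := j.+1) x deg gm _ jm) => //.
  by rewrite leq_mul2l /= IHj //; lia.
have sub : ball k x :|: layer k.+1 x \subset ball k.+1 x.
  by rewrite subUset layer_ball andbT /= subsetUl.
have dis : ball k x :&: layer k.+1 x = set0.
  apply/setP=> y; rewrite in_set0; apply/negP; rewrite inE => /andP[].
  case/ball_upath=> p [up sp lp] /layerP[q [uq sq lq]].
  have E : p = q by apply: (upath_inj gm up uq); rewrite ?lp ?lq //; tlia.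
  by move: sp; rewrite E sq ltnn.
have := subset_leq_card sub; rewrite -/(ball k.+1 x) cardsU dis cards0 subn0.
have := lay k km; have := IHk (leq_trans _ km); rewrite !expnS /=.
move=> H1 H2 H3; have {}H1 := H1 _; lia.
Qed.

End Graph.

(** * Voronoi cells *)

Definition uncovered (T : finType) (S : {set T}) (R : rel T) (X : {set T}) :=
  [set u in S | [forall x in X, ~~ R u x]].

(* Derandomised choice of [t] uniform independent elements of [S]: the vertex
   [u] stays uncovered with probability [(1 - b u / #|S|) ^ t]. *)
Lemma exists_cover (T : finType) (S : {set T}) (R : rel T) (w : T -> nat) t :
  S != set0 ->
  exists X : {set T}, [/\ X \subset S, #|X| <= t &
    (\sum_(u in uncovered S R X) w u) * #|S| ^ t <=
    \sum_(u in S) w u * (#|S| - #|[set x in S | R u x]|) ^ t].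
Proof.
move=> S0; elim: t w => [|t IHt] w.
  exists set0; rewrite sub0set cards0; split=> //.
  rewrite expn0 muln1 (eq_bigl (mem S)); last first.
    by move=> u; rewrite !inE; case: (u \in S) => //=; apply/forallP=> x; rewrite inE.
  by apply: leq_sum => u _; rewrite expn0 muln1.
pose c u := #|S| - #|[set x in S | R u x]|.
(* Up to the factor [#|S| ^ t], the expected weight left uncovered by [x] and [t] further random
   elements; a minimising [x] does no worse than the average. *)
pose W x := \sum_(u in S | ~~ R u x) w u * c u ^ t.
have sumW : \sum_(x in S) W x = \sum_(u in S) w u * c u ^ t.+1.
  rewrite (exchange_big_dep (mem S)) /=; last by move=> x u _ /andP[].
  apply: eq_bigr => u uS; rewrite expnSr mulnA [RHS]mulnC.
  rewrite (eq_bigl (mem (S :\: [set x in S | R u x]))); last first.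
    by move=> x; rewrite !inE uS; case: (x \in S); rewrite ?andbF //= andbT.
  have sub : [set x in S | R u x] \subset S by apply/subsetP=> x; rewrite inE => /andP[].
  by rewrite sum_nat_const cardsD (setIidPr sub).
have [x xS Wx] : exists2 x, x \in S & #|S| * W x <= \sum_(u in S) w u * c u ^ t.+1.
  have [x0 x0S] := set0Pn _ S0.
  case: (arg_minnP W x0S) => x xS Wx; exists x => //.
  rewrite -sumW -sum_nat_const; apply: leq_sum => y yS; exact: Wx.
(* Vertices already covered by [x] get weight 0 for the remaining choices. *)
have [X [XS cX HX]] := IHt (fun u => if R u x then 0 else w u).
exists (x |: X); split.
- by rewrite subUset sub1set xS.
- by rewrite cardsU1; case: (_ \notin _) => /=; lia.
apply: leq_trans Wx; rewrite expnS mulnCA leq_mul2l; apply/orP; right.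
apply: leq_trans (leq_trans HX _); last first.
  rewrite /W big_mkcondr /=; apply: leq_sum => u _; by case: (R u x).
rewrite leq_mul2r; apply/orP; right.
rewrite big_mkcond [leqRHS]big_mkcond /=; apply: leq_sum => u _.
rewrite !inE; case uS: (u \in S) => //=.
case: ifP => // /forall_inP H.
have nR : ~~ R u x by apply: H; rewrite setU11.
rewrite (negPf nR); case: forall_inP => // -[] y yX.
by apply: H; rewrite setU1r.
Qed.

Definition restr (T : finType) (e : rel T) (B : {set T}) : rel T :=
  fun a b => [&& a \in B, b \in B & e a b].

Definition conn (T : finType) (e : rel T) (B : {set T}) :=
  forall x y, x \in B -> y \in B -> connect (restr e B) x y.

(** Minor models between graphs on subsets of one fixed type, so that successive minors compose
    without change of type. *)
Definition model (T : finType) (S' : {set T}) (f : rel T)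
    (S : {set T}) (e : rel T) (B : T -> {set T}) :=
  [/\ forall u, u \in S' -> B u != set0,
      forall u, u \in S' -> B u \subset S,
      forall u v, u \in S' -> v \in S' -> u != v -> [disjoint B u & B v],
      forall u, u \in S' -> conn e (B u)
    & forall u v, u \in S' -> v \in S' -> f u v ->
        exists x y, [/\ x \in B u, y \in B v & e x y]].

Lemma path_restr (T : finType) (e : rel T) (B : {set T}) x p :
  all (fun z => z \in B) (x :: p) -> path e x p -> path (restr e B) x p.
Proof.
elim: p x => [|y p IHp] x //= /and3P[xB yB pB] /andP[xy yp].
by rewrite /restr xB yB xy IHp //= yB.
Qed.

Section Voronoi.

Variables (T : finType) (e : rel T) (X : {set T}).
Hypotheses (e_sym : symmetric e) (e_irr : irreflexive e).

(* The centre of the cell of radius [i] containing [v], if any. *)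
Fixpoint vor i v : option T :=
  if i is j.+1 then
    if vor j v is Some x then Some x
    else if [pick u | e v u & vor j u] is Some u then vor j u else None
  else if v \in X then Some v else None.

Lemma vorS i v x : vor i v = Some x -> vor i.+1 v = Some x.
Proof. by move=> /= ->. Qed.

(** A vertex takes its centre from the neighbour through which it is reached, and assignments never
    change; so the path stays inside the cell. *)
Lemma vor_path i v x : vor i v = Some x ->
  x \in X /\ exists p, [/\ upath e x p, size p <= i, last x p = v &
    all (fun z => vor i z == Some x) (x :: p)].
Proof.
elim: i v => [|i IHi] v.
  rewrite /=; case: ifP => // vX [<-]; split=> //; exists [::].
  by rewrite /= vX eqxx.
move=> vx; have := vx; rewrite [vor _ _]/=; case vi: (vor i v) => [z|].
  case=> zx; have [xX [p [up sp lp ap]]] := IHi v (etrans vi (congr1 _ zx)).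
  split=> //; exists p; split=> //; first exact: leqW.
  by apply: sub_all ap => a /eqP H; apply/eqP; exact: vorS.
case: pickP => // u /andP[vu _] ux.
have [xX [p [up sp lp ap]]] := IHi u ux; split=> //; exists (rcons p v).
rewrite last_rcons size_rcons ltnS upath_rcons up lp e_sym vu /= sp; split=> //.
  by apply/negP=> vp; have := allP ap v vp; rewrite vi.
rewrite -[_ && _]/(all _ (x :: rcons p v)) -rcons_cons all_rcons; apply/andP; split; first exact/eqP.
by apply: sub_all ap => a /eqP H; apply/eqP; exact: vorS.
Qed.

Lemma vor_none i v x : vor i v = None -> x \in X -> x \notin ball e i v.
Proof.
elim: i v => [|i IHi] v /=.
  by case: ifP => // vX _ xX; rewrite inE; apply: contraFneq vX => <-.
case vi: (vor i v) => //; case: pickP => [u /andP[_]|H _ xX]; first by case: (vor i u).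
rewrite inE negb_or IHi //=; apply/negP=> /bigcupP[u]; rewrite inE => vu.
by apply/negP; apply: IHi => //; have := H u; rewrite vu /=; case: (vor i u).
Qed.

Lemma vor_id i x : x \in X -> vor i x = Some x.
Proof. by move=> xX; elim: i => [|i /= ->] //=; rewrite xX. Qed.

Lemma vor_S (S : {set T}) i v : (forall x y, e x y -> x \in S) -> X \subset S ->
  vor i v -> v \in S.
Proof.
move=> eS XS.
case vx: (vor i v) => [x|] // _; have [xX [p [up _ <- _]]] := vor_path vx.
case/lastP: p up => [|p y] /=; first by rewrite (subsetP XS).
by rewrite upath_rcons last_rcons e_sym => /and3P[_ /eS].
Qed.

Variable k : nat.
Hypothesis gk : girth_above e (4 * k + 2).

Definition vadj x y :=
  (x != y) && [exists u, exists v, [&& vor k u == Some x, vor k v == Some y & e u v]].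

Definition cell x := [set v | vor k v == Some x].

Lemma vadj_sym : symmetric vadj.
Proof.
move=> x y; rewrite /vadj eq_sym; congr (_ && _).
by apply/existsP/existsP => -[u /existsP[v /and3P[ux vy uv]]];
  exists v; apply/existsP; exists u; rewrite ux vy e_sym.
Qed.

Lemma vadj_irr : irreflexive vadj.
Proof. by move=> x; rewrite /vadj eqxx. Qed.

Lemma vor_model (S : {set T}) : (forall x y, e x y -> x \in S) -> X \subset S ->
  model X vadj S e cell.
Proof.
move=> eS XS.
split.
- by move=> x xX; apply/set0Pn; exists x; rewrite inE vor_id.
- by move=> x xX; apply/subsetP=> v; rewrite inE => /eqP vx; apply: (vor_S (i := k) eS XS); rewrite vx.
- move=> x y _ _ nxy; rewrite -setI_eq0; apply/eqP/setP=> v; rewrite !inE.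
  by apply/negP=> /andP[/eqP-> /eqP[xy]]; rewrite xy eqxx in nxy.
- move=> x xX.
  have sym : connect_sym (restr e (cell x)).
    by apply: sym_connect_sym => a b; rewrite /restr e_sym andbCA.
  have H v : v \in cell x -> connect (restr e (cell x)) x v.
    rewrite inE => /eqP /vor_path[_ [p [/andP[xp _] _ lp ap]]].
    apply/connectP; exists p => //; apply: path_restr xp.
    by apply: sub_all ap => z; rewrite inE.
  move=> u v uc vc; apply: connect_trans (H v vc); rewrite sym; exact: H.
- move=> x y _ _ /andP[_ /existsP[u /existsP[v /and3P[ux vy uv]]]].
  by exists u, v; rewrite !inE.
Qed.

(** The edge [uv] can be read off the path: [u] is its last vertex in the cell of [x], [v] its first
    in the cell of [y]. Two such paths have total length at most [4 * k + 2], so they coincide, and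
    so do the edges. *)
Lemma bridge u v x y : vor k u = Some x -> vor k v = Some y -> e u v -> x != y ->
  exists p, [/\ upath e x p, last x p = y, size p <= 2 * k + 1,
    last x [seq z <- p | vor k z == Some x] = u &
    head x [seq z <- p | vor k z == Some y] = v].
Proof.
move=> ux vy uv nxy.
have [xX [p [up sp lp ap]]] := vor_path ux.
have [yX [q [uq sq lq aq]]] := vor_path vy.
have rq : rev (y :: q) = v :: rev (belast y q) by rewrite lastI rev_rcons lq.
have fx : [seq z <- p ++ rev (y :: q) | vor k z == Some x] = p.
  rewrite filter_cat; have /andP[_ /all_filterP->] := ap.
  rewrite filter_rev -[RHS]cats0; congr (_ ++ _); rewrite -[RHS]/(rev [::]); congr rev.
  apply/eqP; rewrite -[_ == _]negbK -has_filter; apply/hasPn=> z zq.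
  by move/allP: aq => /(_ z zq) /eqP->; apply: contra nxy => /eqP[->].
have fy : [seq z <- p ++ rev (y :: q) | vor k z == Some y] = rev (y :: q).
  rewrite filter_cat filter_rev; have /all_filterP-> := aq.
  rewrite -[RHS]cat0s; congr (_ ++ _).
  apply/eqP; rewrite -[_ == _]negbK -has_filter; apply/hasPn=> z zp.
  by case/andP: ap => _ /allP/(_ z zp) /eqP->; apply: contra nxy => /eqP[->].
exists (p ++ rev (y :: q)); split; rewrite ?fx ?fy ?lp //; last by rewrite rq.
- have [/andP[Pp Up] /andP[Pq Uq]] := (up, uq).
  apply/andP; split; first by rewrite cat_path Pp lp rq /= uv -{1}lq path_rev.
  rewrite -cat_cons cat_uniq Up rev_uniq Uq andbT; apply/hasPn=> z; rewrite mem_rev => zq.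
  apply/negP=> zp; move/allP: ap => /(_ z zp); move/allP: aq => /(_ z zq) /eqP->.
  by case/eqP=> yx; rewrite yx eqxx in nxy.
- by rewrite last_cat rev_cons last_rcons.
- rewrite size_cat size_rev /=; tlia.
Qed.

Lemma cross_card :
  #|[set z : T * T | [&& e z.1 z.2, vor k z.1 : bool, vor k z.2 : bool & vor k z.1 != vor k z.2]]|
   <= \sum_(x in X) #|[set y in X | vadj x y]|.
Proof.
pose c v := odflt v (vor k v).
set A := [set z | _].
have inj : {in A &, injective (fun z => (c z.1, c z.2))}.
  move=> [u v] [u' v']; rewrite !inE /c /=.
  case ux: (vor k u) => [x|]; case vy: (vor k v) => [y|]; rewrite ?andbF //.
  case ux': (vor k u') => [x'|]; case vy': (vor k v') => [y'|]; rewrite ?andbF //=.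
  move=> /andP[uv nxy] /andP[uv' _] [ex ey]; rewrite -{x'}ex -{y'}ey in ux' vy'.
  have {}nxy : x != y by apply: contraNneq nxy => ->.
  have [p [up lp sp hu hv]] := bridge ux vy uv nxy.
  have [q [uq lq sq hu' hv']] := bridge ux' vy' uv' nxy.
  have E : p = q by apply: (upath_inj e_sym gk up uq); rewrite ?lp ?lq //; tlia.
  by rewrite -hu -hv -hu' -hv' E.
rewrite -(card_in_imset inj).
have -> : \sum_(x in X) #|[set y in X | vadj x y]| =
    #|[set z : T * T | [&& z.1 \in X, z.2 \in X & vadj z.1 z.2]]|.
  rewrite -sum1dep_card (eq_bigl (fun z => (z.1 \in X) && ((z.2 \in X) && vadj z.1 z.2))) //.
  rewrite -(pair_big_dep (mem X) (fun x y => (y \in X) && vadj x y) (fun _ _ => 1)) /=.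
  by apply: eq_bigr => x _; rewrite sum1dep_card.
apply: subset_leq_card; apply/subsetP=> _ /imsetP[[u v] + ->]; rewrite !inE /c /=.
case ux: (vor k u) => [x|]; case vy: (vor k v) => [y|]; rewrite ?andbF //=.
case/andP=> uv nxy; rewrite (vor_path ux).1 (vor_path vy).1 /vadj.
have -> : x != y by apply: contraNneq nxy => ->.
by apply/existsP; exists u; apply/existsP; exists v; rewrite ux vy !eqxx.
Qed.

(** Each cell induces a tree: an inner edge joins a vertex to its predecessor on the short path from
    the centre, so non-centres bound the inner edges. The factor 2 counts both orders. *)
Lemma inner_card :
  #|[set z : T * T | [&& e z.1 z.2, vor k z.1 : bool & vor k z.1 == vor k z.2]]|
   <= 2 * #|[set v | vor k v] :\: X|.
Proof.
have /fin_all_exists[f Pf] v : exists p, forall x, vor k v = Some x ->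
    [/\ upath e x p, size p <= k & last x p = v].
  case vx: (vor k v) => [x|]; last by exists [::].
  by have [_ [p [up sp lp _]]] := vor_path vx; exists p => y [<-].
(* The last vertex but one of the path from the centre to [v]. *)
pose pre v := nth v (rev (odflt v (vor k v) :: f v)) 1.
set N := _ :\: _.
have preP u v x : vor k u = Some x -> vor k v = Some x -> f v = rcons (f u) v ->
    (u == pre v) && (v \in N).
  move=> ux vx E; have [uv _ lv] := Pf v x vx; have [_ _ lu] := Pf u x ux.
  rewrite /pre vx E /= -rcons_cons rev_rcons /= nth0.
  rewrite lastI rev_rcons /= lu eqxx !inE vx andbT.
  apply: contraTN uv => vX; move: vx; rewrite vor_id // => -[<-].
  by rewrite E /upath /= mem_rcons inE eqxx andbF.
have sub : [set z : T * T | [&& e z.1 z.2, vor k z.1 : bool & vor k z.1 == vor k z.2]]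
  \subset [set (pre v, v) | v in N] :|: [set (v, pre v) | v in N].
  apply/subsetP=> -[u v]; rewrite !inE /=.
  case ux: (vor k u) => [x|]; rewrite ?andbF //= => /andP[uv /eqP vx].
  have {}vx := esym vx.
  suff [E|E] : f v = rcons (f u) v \/ f u = rcons (f v) u.
  - have /andP[/eqP pu vN] := preP _ _ _ ux vx E.
    by apply/orP; left; apply/imsetP; exists v; rewrite // -pu.
  - have /andP[/eqP pu vN] := preP _ _ _ vx ux E.
    by apply/orP; right; apply/imsetP; exists u; rewrite // -pu.
  have [pu su lu] := Pf u x ux; have [pv sv lv] := Pf v x vx.
  (* If [v] is off the path to [u], appending [v] yields the path to [v]; otherwise the roles of [u]
     and [v] are exchanged. *)
  have [vp|vp] := boolP (v \in x :: f u); [right|left]; last first.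
    apply: (upath_inj e_sym gk pv); rewrite ?upath_rcons ?pu ?lu ?uv ?vp ?last_rcons //.
    by rewrite size_rcons; tlia.
  have nvu : v != u by apply: contraTneq uv => ->; rewrite e_irr.
  have E : upath e x (rcons (f v) u).
    rewrite upath_rcons pv lv e_sym uv /=; apply/negP => up.
    move: vp pu su lu; case/splitPl => p1 p2 l1 pu su lu.
    have E : f v = p1.
      apply: (upath_inj e_sym gk pv (upath_catl pu)); rewrite ?lv ?l1 //.
      by move: su; rewrite size_cat; tlia.
    move: up; rewrite E => up; case/andP: pu => _; rewrite -cat_cons cat_uniq => /and3P[_ /hasPn H _].
    move: lu; rewrite last_cat l1 => lu.
    have u2 : u \in p2 by move: (mem_last v p2); rewrite lu inE eq_sym (negPf nvu).
    by have := H u u2; rewrite /= up.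
  by apply: (upath_inj e_sym gk pu E); rewrite ?last_rcons // size_rcons; tlia.
apply: leq_trans (subset_leq_card sub) _; rewrite cardsU mul2n -addnn.
by apply: leq_trans (leq_subr _ _) _; rewrite leq_add // leq_imset_card.
Qed.

End Voronoi.

(** * Suppression of vertices of degree two *)

Lemma restr_sub (T : finType) (e : rel T) (B C : {set T}) :
  B \subset C -> subrel (connect (restr e B)) (connect (restr e C)).
Proof.
move=> BC; apply: connect_sub => a b /and3P[aB bB ab]; apply: connect1.
by rewrite /restr (subsetP BC _ aB) (subsetP BC _ bB).
Qed.

Lemma conn_set1 (T : finType) (e : rel T) x : conn e [set x].
Proof. by move=> a b; rewrite !inE => /eqP-> /eqP->; exact: connect0. Qed.

Lemma model_id (T : finType) (e : rel T) (S : {set T}) : model S e S e set1.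
Proof.
split.
- by move=> u _; apply/set0Pn; exists u; rewrite inE.
- by move=> u uS; rewrite sub1set.
- by move=> u v _ _ uv; rewrite disjoints1 inE.
- by move=> u _; exact: conn_set1.
- by move=> u v _ _ uv; exists u, v; rewrite !inE.
Qed.

Lemma model_comp (T : finType) (S0 S1 S2 : {set T}) (e0 e1 e2 : rel T) B B' :
  model S1 e1 S0 e0 B -> model S2 e2 S1 e1 B' ->
  model S2 e2 S0 e0 (fun u => \bigcup_(x in B' u) B x).
Proof.
case=> [n1 s1 d1 c1 h1] [n2 s2 d2 c2 h2]; split.
- move=> u uS; have [x xB] := set0Pn _ (n2 u uS).
  have [y yB] := set0Pn _ (n1 x (subsetP (s2 u uS) x xB)).
  by apply/set0Pn; exists y; apply/bigcupP; exists x.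
- by move=> u uS; apply/bigcupsP=> x xB; apply: s1; exact: subsetP (s2 u uS) x xB.
- move=> u v uS vS uv; rewrite -setI_eq0; apply/eqP/setP=> z; rewrite !inE.
  apply/negP=> /andP[/bigcupP[x xu zx] /bigcupP[y yv zy]].
  have xy : x != y.
    apply: contraTneq (d2 u v uS vS uv) => xy; rewrite -setI_eq0; apply/set0Pn.
    by exists x; rewrite inE xu xy.
  have := d1 x y (subsetP (s2 u uS) x xu) (subsetP (s2 v vS) y yv) xy.
  by rewrite -setI_eq0 => /eqP/setP/(_ z); rewrite !inE zx zy.
- move=> u uS; set W := \bigcup_(x in B' u) B x.
  have sub x : x \in B' u -> B x \subset W by move=> xu; exact: bigcup_sup.
  have step x a b : x \in B' u -> a \in B x -> b \in B x -> connect (restr e0 W) a b.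
    move=> xu ax bx; apply: restr_sub (sub x xu) _ _ _.
    by apply: c1 => //; exact: subsetP (s2 u uS) x xu.
  move=> a b /bigcupP[x xu ax] /bigcupP[y yu By].
  have /connectP[p xp yE] := c2 u uS x y xu yu.
  (* Follows a path in [B' u], passing from [B x] to [B z] along an edge that realises [xz]. *)
  elim: p x xu a ax xp yE => [|z p IHp] x xu a ax /= => [_ yE|/andP[/and3P[_ zu xz] zp] yE].
    by apply: (step x) => //; rewrite -yE.
  have [c [c' [cx cz cc]]] := h1 x z (subsetP (s2 u uS) x xu) (subsetP (s2 u uS) z zu) xz.
  apply: connect_trans (step x a c xu ax cx) _.
  apply: connect_trans (connect1 _) (IHp z zu c' cz zp yE).
  by rewrite /restr (subsetP (sub x xu) _ cx) (subsetP (sub z zu) _ cz).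
- move=> u v uS vS uv; have [x [y [xu yv xy]]] := h2 u v uS vS uv.
  have [a [b [ax By ab]]] := h1 x y (subsetP (s2 u uS) x xu) (subsetP (s2 v vS) y yv) xy.
  by exists a, b; split=> //; apply/bigcupP; [exists x|exists y].
Qed.

Fixpoint wt (T : Type) (w : T -> T -> nat) x p :=
  if p is y :: p' then w x y + wt w y p' else 0.

(* The second path condition says that ears have weight at most [q]. *)
Definition wgraph (T : finType) (S : {set T}) (e : rel T) (w : T -> T -> nat) M q :=
  [/\ symmetric e /\ irreflexive e,
      forall x y, e x y -> x \in S,
      forall x, x \in S -> 1 < #|nbr e x|,
      forall x p, upath e x p -> e (last x p) x -> 1 < size p ->
        M < wt w x p + w (last x p) x
    & forall x p, upath e x p ->
        (forall z, z \in p -> z != last x p -> #|nbr e z| = 2) -> wt w x p <= q].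

Section Suppress.

Variables (T : finType) (S : {set T}) (e : rel T) (w : T -> T -> nat) (M q : nat).
Hypotheses (W : wgraph S e w M q) (qM : 3 * q <= M).
Variables (v a b : T).
Hypotheses (nv : nbr e v = [set a; b]) (nab : a != b).

Let e_sym : symmetric e. Proof. by case: W => -[]. Qed.
Let e_irr : irreflexive e. Proof. by case: W => -[]. Qed.
Let eS x y : e x y -> x \in S. Proof. case: W => _ h _ _ _; exact: h. Qed.
Let va : e v a. Proof. by have := set21 a b; rewrite -nv inE. Qed.
Let vb : e v b. Proof. by have := set22 a b; rewrite -nv inE. Qed.
Let nva : v != a. Proof. by apply: contraTneq va => <-; rewrite e_irr. Qed.
Let nvb : v != b. Proof. by apply: contraTneq vb => <-; rewrite e_irr. Qed.

(** An edge is an ear without internal vertices. *)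
Let e_le x y : e x y -> w x y <= q.
Proof.
move=> xy; case: W => _ _ _ _ /(_ x [:: y]); rewrite /= addn0; apply.
  rewrite /upath /= xy inE /= andbT.
  by apply: contraTneq xy => ->; rewrite e_irr.
by move=> z; rewrite inE => ->.
Qed.

(** The triangle on [v], [a], [b] would weigh at most [3 * q <= M]. Hence suppressing [v] creates no
    parallel edge. *)
Let nadj : ~~ e a b.
Proof.
apply/negP=> ab; case: W => _ _ _ /(_ v [:: a; b]) H _.
have : M < w v a + (w a b + 0) + w b v.
  apply: H => //=; last by rewrite e_sym.
  by rewrite /upath /= va ab !inE negb_or nva nvb nab.
have := e_le va; have := e_le ab; have bv : e b v by rewrite e_sym.
have := e_le bv; move: qM; lia.
Qed.

(* The vertex [v] of degree 2 is replaced by an edge between its neighbours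
   [a] and [b], the special edge; [expand] re-inserts [v] into a path. *)
Definition spec x y := (x == a) && (y == b) || (x == b) && (y == a).
Definition sup_e x y := spec x y || [&& e x y, x != v & y != v].
Definition sup_w x y := if spec x y then w x v + w v y else w x y.
Fixpoint expand x p :=
  if p is y :: p' then
    if spec x y then [:: v, y & expand y p'] else y :: expand y p'
  else [::].

Lemma spec_sym : symmetric spec.
Proof. by move=> x y; rewrite /spec orbC ![(y == _) && _]andbC. Qed.

Lemma spec_e x y : spec x y -> e x v && e v y.
Proof. by case/orP=> /andP[/eqP-> /eqP->]; rewrite [e _ v]e_sym va vb. Qed.

Lemma spec_neq x y : spec x y -> (x != v) && (y != v).
Proof. by case/orP=> /andP[/eqP-> /eqP->]; rewrite !(eq_sym _ v) nva nvb. Qed.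

Lemma sup_neq x y : sup_e x y -> (x != v) && (y != v).
Proof. by case/orP=> [/spec_neq|/andP[]]. Qed.

Lemma sup_path x p : path sup_e x p -> p != [::] -> v \notin x :: p.
Proof.
elim: p x => [|y p IHp] x //= /andP[/sup_neq /andP[xv yv] yp] _.
rewrite inE negb_or eq_sym xv /=; case: p yp IHp => [|z p] yp IHp.
  by rewrite inE eq_sym.
exact: IHp.
Qed.

Lemma expand_last x p : last x (expand x p) = last x p.
Proof. by elim: p x => [|y p IHp] x //=; case: ifP => _ /=. Qed.

Lemma expand_path x p : path sup_e x p -> path e x (expand x p).
Proof.
elim: p x => [|y p IHp] x //= /andP[xy yp].
case: ifP => [/spec_e /andP[xv vy]|sp] /=; first by rewrite xv vy IHp.
by move: xy; rewrite /sup_e sp /= => /andP[-> _]; rewrite IHp.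
Qed.

Lemma expand_wt x p : wt sup_w x p = wt w x (expand x p).
Proof.
by elim: p x => [|y p IHp] x //=; rewrite /sup_w; case: ifP => _ /=; rewrite IHp ?addnA.
Qed.

Lemma expand_mem x p z : z \in expand x p -> (z == v) || (z \in p).
Proof.
elim: p x => [|y p IHp] x //=; case: ifP => _; rewrite !inE.
  by case/or3P=> [->|->|/IHp/orP[]->]; rewrite ?orbT.
by case/orP=> [->|/IHp/orP[]->]; rewrite ?orbT.
Qed.

Lemma expand_id x p : (a \notin x :: p) || (b \notin x :: p) -> expand x p = p.
Proof.
elim: p x => [|y p IHp] x //=; rewrite !inE !negb_or => H.
rewrite IHp; last by rewrite !inE !negb_or; case/orP: H => /and3P[_ -> ->]; rewrite ?orbT.
case: ifP => // /orP[] /andP[/eqP ? /eqP ?]; subst; move: H;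
  by rewrite !eqxx ?andbF.
Qed.

Lemma expand_size x p : size p <= size (expand x p).
Proof.
elim: p x => [|y p IHp] x //=; case: ifP => _ /=; last by rewrite ltnS.
by rewrite ltnS; exact: leqW.
Qed.

(** A path without repeated vertices uses the special edge at most once, so [v] is inserted at most
    once. *)
Lemma expand_uniq x p : v \notin x :: p -> uniq (x :: p) -> uniq (x :: expand x p).
Proof.
elim: p x => [|y p IHp] x //; rewrite inE negb_or => /andP[vx vp] /=.
move=> /andP[xyp /andP[yp up]].
have U : uniq (y :: expand y p) by apply: IHp => //=; rewrite yp.
case: ifP => [sp|_].
  have E : expand y p = p.
    apply: expand_id; case/orP: sp => /andP[/eqP xa /eqP yb]; move: xyp; rewrite xa => ->//.
    by rewrite orbT.
  by rewrite E /= inE negb_or eq_sym vx xyp vp yp up.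
rewrite /= in U *; rewrite U andbT; apply: contra xyp; rewrite !inE => /orP[->//|/expand_mem].
by rewrite eq_sym (negPf vx) /= => ->; rewrite orbT.
Qed.

Lemma sup_upath x p : upath sup_e x p -> upath e x (expand x p).
Proof.
case/andP=> xp up; rewrite /upath expand_path //=.
case: p xp up => [|y p] xp up //.
by apply: expand_uniq up; apply: sup_path.
Qed.

Lemma sup_e_sym : symmetric sup_e.
Proof.
by move=> x y; rewrite /sup_e spec_sym e_sym; congr (_ || (_ && _)); rewrite andbC.
Qed.

Lemma sup_e_irr : irreflexive sup_e.
Proof.
move=> x; rewrite /sup_e e_irr /= orbF /spec.
by apply/negP=> /orP[] /andP[/eqP-> ]; rewrite ?(negPf nab) // eq_sym (negPf nab).
Qed.

(** [a] and [b] each trade [v] for the other, which by [nadj] is a new neighbour; no other vertex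
    was adjacent to [v]. *)
Lemma sup_nbr x : x != v -> #|nbr sup_e x| = #|nbr e x|.
Proof.
have main c d : e v c -> ~~ e c d -> (forall y, sup_e c y = (y == d) || (e c y && (y != v))) ->
   #|nbr sup_e c| = #|nbr e c|.
  move=> vc ncd H; have -> : nbr sup_e c = d |: (nbr e c :\ v).
    by apply/setP=> y; rewrite !inE H; rewrite andbC.
  rewrite cardsU1 !inE (negPf ncd) andbF /=.
  by rewrite [RHS](cardsD1 v) inE e_sym vc.
move=> xv; have [->|xa] := eqVneq x a.
  apply: (main a b) => // y.
  by rewrite /sup_e /spec eqxx (negPf nab) /= orbF [a == v]eq_sym nva.
have [->|xb] := eqVneq x b.
  apply: (main b a) => [//||y]; first by rewrite e_sym.
  by rewrite /sup_e /spec eqxx [b == a]eq_sym (negPf nab) /= [b == v]eq_sym nvb.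
congr #|pred_of_set _|; apply/setP=> y; rewrite !inE /sup_e /spec (negPf xa) (negPf xb) xv /=.
case xy: (e x y) => //=; apply: contraTneq xy => ->; apply/negP; rewrite e_sym => vx.
have : x \in nbr e v by rewrite inE.
by rewrite nv !inE (negPf xa) (negPf xb).
Qed.

(** Cycles and ears expand to cycles and ears of the old graph with the same weight, since the
    inserted [v] has degree 2 and other degrees are unchanged. *)
Lemma sup_wgraph : wgraph (S :\ v) sup_e sup_w M q.
Proof.
case: (W) => _ _ degS cyc ear; split.
- split; [exact: sup_e_sym | exact: sup_e_irr].
- move=> x y xy; rewrite !inE; have /andP[-> _] /= := sup_neq xy.
  by case/orP: xy => [/spec_e/andP[/eS]|/andP[/eS]].
- by move=> x; rewrite !inE => /andP[xv xS]; rewrite sup_nbr // degS.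
- move=> x p up xl sp; have Up := sup_upath up; rewrite expand_wt.
  move: xl; rewrite /sup_e /sup_w; case: ifP => [lx _|_ /= /andP[lx _]].
    (* The closing edge is the special one, so the path itself does not use it; here [v] has to be
       appended at the end instead. *)
    have E : expand x p = p.
      case: p up sp lx {Up} => [|y p] // up sp lx.
      case/andP: up => _ /= /and3P[xyp yp _].
      have ny : spec x y = false.
        apply/negP=> xy; case: p sp lx xyp yp => [|z p] //= _ lx _ yp.
        have yl : y = last z p.
          move: nab; case/orP: lx => /andP[/eqP-> /eqP xE];
            case/orP: xy => /andP[/eqP xE' /eqP->] => //; by rewrite -xE -xE' eqxx.
        by move: yp; rewrite yl mem_last.
      rewrite /= ny; congr (_ :: _); apply: expand_id.
      by case/orP: lx => /andP[_ /eqP xE]; rewrite -xE xyp ?orbT.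
    have /andP[lv vx] := spec_e lx; rewrite E in Up *.
    have vp : v \notin x :: p.
      by apply: sup_path; [case/andP: up|case: (p) sp].
    have U : upath e x (rcons p v) by rewrite upath_rcons Up lv vp.
    have := cyc _ _ U; rewrite last_rcons size_rcons => /(_ vx (leqW sp)).
    suff -> : wt w x (rcons p v) = wt w x p + w (last x p) v by rewrite addnA.
    by elim: (p) (x) => [|y s IHs] z /=; rewrite ?addn0 // IHs addnA.
  have := cyc _ _ Up; rewrite expand_last; apply=> //.
  exact: leq_trans sp (expand_size _ _).
- move=> x p up deg2; rewrite expand_wt; apply: ear; first exact: sup_upath.
  move=> z /expand_mem; rewrite expand_last; case: eqVneq => [-> _ _|zv /= zp zl].
    by rewrite nv cards2 nab.
  by rewrite -sup_nbr // deg2.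
Qed.

(** [v] joins the branch set of [a], so the edge from [v] to [b] realises the special edge. *)
Lemma sup_model : exists B, model (S :\ v) sup_e S e B.
Proof.
exists (fun u => if u == a then [set a; v] else [set u]); split.
- move=> u _; apply/set0Pn; exists u; case: eqP => [->|_]; by rewrite !inE eqxx.
- move=> u; rewrite !inE => /andP[uv uS]; case: eqP => [_|_]; last by rewrite sub1set.
  apply/subsetP=> x; rewrite !inE => /orP[] /eqP->; last exact: (eS va).
  by apply: (@eS a v); rewrite e_sym.
- move=> x y; rewrite !inE => /andP[xv _] /andP[yv _] xy.
  rewrite -setI_eq0; apply/eqP/setP=> z; rewrite in_set0 inE.
  apply/negP=> /andP[zx zy]; have [xa|xa] := eqVneq x a; have [ya|ya] := eqVneq y a.
  + by rewrite xa ya eqxx in xy.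
  + rewrite xa eqxx !inE in zx; rewrite (negPf ya) inE in zy.
    by rewrite (eqP zy) (negPf ya) (negPf yv) in zx.
  + rewrite ya eqxx !inE in zy; rewrite (negPf xa) inE in zx.
    by rewrite (eqP zx) (negPf xa) (negPf xv) in zy.
  + rewrite (negPf xa) inE in zx; rewrite (negPf ya) inE in zy.
    by rewrite -(eqP zx) -(eqP zy) eqxx in xy.
- move=> u _; case: eqP => _; last exact: conn_set1.
  move=> x y; rewrite !inE => /orP[]/eqP-> /orP[]/eqP->; rewrite ?connect0 //;
    by apply: connect1; rewrite /restr !inE !eqxx ?orbT //= e_sym.
- move=> x y _ _ /orP[/orP[]/andP[/eqP-> /eqP->]|/and3P[xy _ _]].
  + exists v, b; rewrite eqxx [b == a]eq_sym (negPf nab) !inE !eqxx orbT; split=> //.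
  + exists b, v; rewrite eqxx [b == a]eq_sym (negPf nab) !inE !eqxx orbT e_sym; split=> //.
  + by exists x, y; split=> //; case: eqP => [->|_]; rewrite !inE eqxx.
Qed.

End Suppress.

(** * Density of the contracted graph *)

From Stdlib Require Import ZArith Reals Lra Classical.

Lemma card_setU4 (V : finType) (A A1 A2 A3 A4 : {set V}) :
  A \subset A1 :|: A2 :|: A3 :|: A4 -> #|A| <= #|A1| + #|A2| + #|A3| + #|A4|.
Proof.
move=> /subset_leq_card H; apply: leq_trans H _.
have cU (B C : {set V}) : #|B :|: C| <= #|B| + #|C| by rewrite cardsU leq_subr.
apply: leq_trans (cU _ _) _; rewrite leq_add2r.
apply: leq_trans (cU _ _) _; rewrite leq_add2r; exact: cU.
Qed.

(** An ordered adjacent pair starts outside the cells, ends outside them, stays in one cell or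
    crosses. The cells span a forest with at most [#|S| - #|U| - #|X|] edges, so a vertex [u] of [U]
    costs only twice its degree minus one. *)
Lemma voronoi_count (T : finType) (e : rel T) (S X : {set T}) k :
  symmetric e -> irreflexive e ->
  (forall x y, e x y -> x \in S) -> X \subset S ->
  girth_above e (4 * k + 2) -> (forall x, x \in S -> 0 < #|nbr e x|) ->
  \sum_(x in S) #|nbr e x| + 2 * #|X| <=
  \sum_(x in X) #|[set y in X | vadj e X k x y]|
  + 2 * (\sum_(u in uncovered S (fun u x => x \in ball e k u) X) #|nbr e u|.-1)
  + 2 * #|S|.
Proof.
move=> e_sym e_irr eS XS gk deg.
pose c := vor e X k.
pose U := [set u in S | ~~ c u].
pose sumU := \sum_(u in U) #|nbr e u|.
have cardP (P : pred T) : #|[set z : T * T | P z.1 && e z.1 z.2]| = \sum_(x | P x) #|nbr e x|.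
  rewrite -sum1dep_card -(pair_big_dep P e (fun _ _ => 1)) /=.
  by apply: eq_bigr => x _; rewrite sum1dep_card.
have Esum : #|[set z : T * T | (z.1 \in S) && e z.1 z.2]| = \sum_(x in S) #|nbr e x| by exact: cardP.
have EU : #|[set z : T * T | (z.1 \in U) && e z.1 z.2]| = sumU by exact: cardP.
have EU' : #|[set z : T * T | (z.2 \in U) && e z.1 z.2]| = sumU.
  pose sw (z : T * T) := (z.2, z.1).
  have swK : involutive sw by case.
  rewrite -EU -(card_imset _ (inv_inj swK)); apply: eq_card => -[u v].
  apply/imsetP/idP=> [[[a b] + [-> ->]]|]; rewrite !inE /= => /andP[aU ab].
    by rewrite aU e_sym.
  by exists (v, u); rewrite // !inE /= aU e_sym.
have cS : [set v | c v] :\: X = S :\: U :\: X.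
  apply/setP=> v; rewrite !inE; case cv: (c v) => [x|] /=; rewrite ?andbF ?andbT //.
    have -> : v \in S by apply: (vor_S (i := k) e_sym eS XS); rewrite -/(c v) cv.
    by rewrite ?andbT.
  by case: (v \in S); rewrite ?andbF.
have cardN : #|[set v | c v] :\: X| + #|X| + #|U| = #|S|.
  rewrite cS; have US : U \subset S by apply/subsetP=> u; rewrite inE => /andP[].
  have XSU : X \subset S :\: U.
    by apply/subsetP=> x xX; rewrite !inE (subsetP XS) // /c vor_id.
  rewrite cardsD (setIidPr XSU) subnK ?subset_leq_card //.
  by rewrite cardsD (setIidPr US) subnK ?subset_leq_card.
pose I := [set z : T * T | [&& e z.1 z.2, c z.1 : bool & c z.1 == c z.2]].
pose J := [set z : T * T | [&& e z.1 z.2, c z.1 : bool, c z.2 : bool & c z.1 != c z.2]].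
have sub : \sum_(x in S) #|nbr e x| <= sumU + sumU + #|I| + #|J|.
  rewrite -Esum -{1}EU -EU'; apply: card_setU4; apply/subsetP=> -[u v].
  rewrite !inE /= => /andP[uS uv]; rewrite uS uv /=.
  have -> /= : v \in S by move: uv; rewrite e_sym; exact: eS.
  by case: (c u) (c v) => [x|] [y|] //=; rewrite orbN.
have cI : #|I| <= 2 * #|[set v | c v] :\: X| := inner_card X e_sym e_irr gk.
have cJ : #|J| <= \sum_(x in X) #|[set y in X | vadj e X k x y]| := cross_card X e_sym gk.
have HU : sumU <= \sum_(u in U) #|nbr e u|.-1 + #|U|.
  rewrite -sum1_card -big_split /=; apply: leq_sum => u; rewrite inE => /andP[uS _].
  by rewrite addn1 prednK ?deg.
have HU' : \sum_(u in U) #|nbr e u|.-1 <=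
    \sum_(u in uncovered S (fun u x => x \in ball e k u) X) #|nbr e u|.-1.
  rewrite big_mkcond [leqRHS]big_mkcond; apply: leq_sum => u _; rewrite !inE.
  case: (u \in S) => //=; case cu: (c u) => [x|] //=.
  case: forall_inP => // -[] x xX; exact: vor_none cu xX.
lia.
Qed.


(** * Exponential decay of the uncovered weight *)

Lemma exp_pow x n : (exp x ^ n = exp (INR n * x))%R.
Proof.
elim: n => [|n IHn]; first by rewrite Rmult_0_l exp_0.
rewrite S_INR -tech_pow_Rmult IHn -exp_plus; congr exp; lra.
Qed.

Lemma INR_expn a n : INR (expn a n) = (INR a ^ n)%R.
Proof. by elim: n => [|n IHn] //; rewrite expnS mult_INR IHn. Qed.

(* The exponent [b * t / n] is at least [(3 * D + 1) / 4], and
   [16 * (D - 1) <= 3 * exp ((3 * D + 1) / 4)] because [32 <= 3 * exp (5 / 2)]. *)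
Lemma weight_decay (D b n t k : nat) : 3 <= D -> 2 <= k ->
  D * expn 2 k + 1 <= b + D -> b <= n -> n <= t * expn 2 k ->
  16 * D.-1 * expn (n - b) t <= 3 * expn n t.
Proof.
move=> D3 k2 Db bn nt.
have n0 : (0 < INR n)%R.
  apply: (lt_INR 0); apply/ltP; apply: leq_trans bn.
  have : 0 < expn 2 k by rewrite expn_gt0.
  by nia.
have K4 : (4 <= INR (expn 2 k))%R.
  have H : expn 2 2 <= expn 2 k by rewrite leq_exp2l.
  by have := le_INR _ _ (elimT leP H); rewrite /=; lra.
set K := INR (expn 2 k) in K4.
have Db' : (INR D * K + 1 <= INR b + INR D)%R.
  by have := le_INR _ _ (elimT leP Db); rewrite !plus_INR mult_INR.
have nt' : (INR n <= INR t * K)%R.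
  by have := le_INR _ _ (elimT leP nt); rewrite mult_INR.
have bn' : (INR b <= INR n)%R by apply: le_INR; apply/leP.
have D3' : (3 <= INR D)%R by have := le_INR _ _ (elimT leP D3); rewrite /=; lra.
have [x xE] : exists x, x = (INR b / INR n)%R by eexists.
have bx : INR b = (x * INR n)%R by rewrite xE; field; lra.
have x1 : (1 - x <= exp (- x))%R by have := exp_ineq1_le (- x); lra.
have x01 : (0 <= 1 - x)%R by have := bn'; rewrite bx; nra.
have b0 : (0 <= INR b)%R by apply: pos_INR.
(* [t * x >= b / K >= D - (D - 1) / K], which increases with [K], and [K >= 4]. *)
have tx : (INR t * x >= (3 * INR D + 1) / 4)%R.
  have H1 : (INR b <= (INR t * x) * K)%R.
    have x0 : (0 <= x)%R by have := b0; rewrite bx; nra.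
    rewrite bx; have := Rmult_le_compat_l _ _ _ x0 nt'; lra.
  have H2 : ((3 * INR D + 1) / 4 * K <= INR t * x * K)%R by nra.
  apply: Rle_ge; apply: Rmult_le_reg_r H2; lra.
have P : ((1 - x) ^ t <= exp (- ((3 * INR D + 1) / 4)))%R.
  apply: (Rle_trans _ (exp (- x) ^ t)); first by apply: pow_incr; lra.
  rewrite exp_pow; have H : (INR t * - x <= - ((3 * INR D + 1) / 4))%R by lra.
  by case: H => [/exp_increasing|->]; lra.
have e52 : (32 <= 3 * exp (5 / 2))%R.
  have -> : (5 / 2 = INR 25 * (1 / 10))%R by rewrite /=; lra.
  (* [exp (5 / 2)] is the 25th power of [exp (1 / 10) >= 1.1], and [1.1 ^ 25 > 32 / 3]. *)
  rewrite -exp_pow; have H := exp_ineq1_le (1 / 10).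
  have : ((1 + 1 / 10) ^ 25 <= exp (1 / 10) ^ 25)%R by apply: pow_incr; lra.
  lra.
have main : (16 * (INR D - 1) * exp (- ((3 * INR D + 1) / 4)) <= 3)%R.
  (* The exponent is [5 / 2 + j / 2 + j / 4]: the first term pays for the constant, the second for
     the growth of [D - 1 = 2 (1 + j / 2)]. *)
  pose j := (INR D - 3)%R.
  have -> : (- ((3 * INR D + 1) / 4) = - (5 / 2) + (- (j / 2) + - (j / 4)))%R by rewrite /j; field.
  have -> : (INR D - 1 = 2 * (1 + j / 2))%R by rewrite /j; field.
  have j0 : (0 <= j)%R by rewrite /j; lra.
  rewrite !exp_plus !exp_Ropp.
  have h1 := exp_ineq1_le (j / 2); have h2 := exp_ineq1_le (j / 4).
  have h3 : (0 < exp (j / 2))%R := exp_pos _; have h4 : (0 < exp (j / 4))%R := exp_pos _.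
  have h5 : (0 < exp (5 / 2))%R := exp_pos _.
  have i1 : ((1 + j / 2) * / exp (j / 2) <= 1)%R.
    apply: (Rmult_le_reg_r (exp (j / 2))) => //; rewrite Rmult_assoc Rinv_l; lra.
  have i2 : (0 < / exp (j / 4) <= 1)%R.
    split; first exact: Rinv_0_lt_compat.
    rewrite -Rinv_1; apply: Rinv_le_contravar; lra.
  have i3 : (32 * / exp (5 / 2) <= 3)%R.
    apply: (Rmult_le_reg_r (exp (5 / 2))) => //; rewrite Rmult_assoc Rinv_l; lra.
  have i5 : (0 < / exp (5 / 2))%R by exact: Rinv_0_lt_compat.
  have i4 : (((1 + j / 2) * / exp (j / 2)) * / exp (j / 4) <= 1)%R.
    have i6 : (0 <= (1 + j / 2) * / exp (j / 2))%R.
      by apply: Rmult_le_pos; [lra | apply: Rlt_le; exact: Rinv_0_lt_compat].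
    nra.
  set A := (_ * / exp (j / 4))%R in i4.
  apply: (Rle_trans _ (32 * / exp (5 / 2) * A)); first by rewrite /A; lra.
  nra.
apply/leP; apply: INR_le; rewrite !mult_INR !INR_expn minus_INR; last exact/leP.
have -> : INR D.-1 = (INR D - 1)%R by rewrite -subn1 minus_INR //; apply/leP; lia.
have -> : (INR n - INR b = INR n * (1 - x))%R by rewrite bx; ring.
rewrite Rpow_mult_distr.
have nt0 : (0 < INR n ^ t)%R by apply: pow_lt.
have -> : INR 16 = 16%R by rewrite /=; lra.
have -> : INR 3 = 3%R by rewrite /=; lra.
have : (16 * (INR D - 1) * (1 - x) ^ t <= 3)%R.
  apply: Rle_trans main; apply: Rmult_le_compat_l => //; lra.
nra.
Qed.

Lemma dense_cells (T : finType) (e : rel T) (S : {set T}) k :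
  symmetric e -> irreflexive e -> (forall x y, e x y -> x \in S) ->
  girth_above e (4 * k + 2) -> (forall x, x \in S -> 2 < #|nbr e x|) ->
  S != set0 -> 2 <= k ->
  exists X : {set T}, [/\ X \subset S, X != set0 &
    (64 + 15 * expn 2 k) * #|X| <=
    32 * \sum_(x in X) #|[set y in X | vadj e X k x y]|].
Proof.
move=> e_sym e_irr eS gk deg S0 k2.
pose n := #|S|; pose K := expn 2 k.
have K4 : 4 <= K by rewrite -[4]/(expn 2 2) leq_exp2l.
have deg' y z : e y z -> 2 < #|nbr e z| by rewrite e_sym => /eS /deg.
have ballS i x : x \in S -> ball e i x \subset S.
  move=> xS; apply/subsetP=> y /ball_upath[p [/andP[xp _] _ <-]].
  elim: p x xS xp => [|z p IHp] x xS //= /andP[xz]; apply: IHp.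
  by move: xz; rewrite e_sym => /eS.
have ballb x : x \in S -> #|nbr e x| * K + 1 <= #|ball e k x| + #|nbr e x|.
  by move=> _; apply: (ball_card e_sym e_irr x deg' gk); lia.
(* A single ball around a vertex of degree at least 3 already has [3 K - 2] vertices. *)
have n3 : 3 * K <= n + 2.
  have [x xS] := set0Pn _ S0.
  have := subset_leq_card (ballS k x xS); have := ballb x xS; have := deg x xS.
  rewrite -/n; nia.
(* [t] is the ceiling of [n / 2 ^ k]; as [3 * 2 ^ k <= n + 2], it is at most
   [4 n / (3 * 2 ^ k)]. *)
pose t := (n + K.-1) %/ K.
have tK : n <= t * K.
  have := ltn_ceil (n + K.-1) (ltn_trans (isT : 0 < 3) K4); rewrite -/t mulSn; lia.
have tK' : t * K <= n + K.-1 by exact: leq_trunc_div.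
(* Degree minus one is the cost of an uncovered vertex in [voronoi_count]; the factor 16 clears the
   denominator of the bound [3 n / 16]. *)
have [X [XS Xt HX]] := exists_cover (fun u x => x \in ball e k u)
  (fun u => 16 * #|nbr e u|.-1) t S0.
exists X.
set U := uncovered S _ X in HX.
pose sU := \sum_(u in U) #|nbr e u|.-1.
have n0 : 0 < n by rewrite /n card_gt0.
have H16 : 16 * sU <= 3 * n.
  have : 16 * sU * expn n t <= 3 * n * expn n t.
    rewrite /sU big_distrr /=; apply: leq_trans HX _.
    rewrite -mulnA mulnCA -sum_nat_const; apply: leq_sum => u uS.
    have bE : [set x in S | x \in ball e k u] = ball e k u.
      apply/setP=> x; rewrite inE; case: (boolP (x \in ball e k u)) => H; rewrite ?andbF //.
      by rewrite (subsetP (ballS k u uS)).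
    rewrite bE; apply: (weight_decay (k := k)) => //; [exact: deg|exact: ballb|].
    exact: subset_leq_card (ballS k u uS).
  by rewrite leq_pmul2r // expn_gt0 n0.
have deg1 x : x \in S -> 0 < #|nbr e x| by move=> /deg; lia.
have V := voronoi_count e_sym e_irr eS XS gk deg1.
rewrite -/U -/sU -/n in V.
have D3 : 3 * n <= \sum_(x in S) #|nbr e x|.
  by rewrite mulnC -sum_nat_const; apply: leq_sum => x; exact: deg.
split=> //.
  (* Without centres everything is uncovered and [sU >= 2 n], against [16 * sU <= 3 * n]. *)
  apply/negP=> /eqP E.
  have US : U = S.
    apply/setP=> u; rewrite inE; case: (u \in S) => //=.
    by apply/forall_inP => x; rewrite E inE.
  have : 2 * n <= sU.
    rewrite /sU US mulnC -sum_nat_const; apply: leq_sum => x /deg; lia.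
  lia.
have : K * #|X| <= t * K by rewrite mulnC leq_mul2r Xt orbT.
rewrite -/K; set a := \sum_(x in X) _ in V *; move=> HK.
have -> : (64 + 15 * K) * #|X| = 64 * #|X| + 15 * (K * #|X|) by rewrite mulnDl mulnA.
(* [a >= n + 2 #|X| - 2 sU >= 5 n / 8 + 2 #|X|], and [K #|X| <= 4 n / 3] turns [5 n / 8] into
   [15 K #|X| / 32]. *)
move: HK tK' V D3 H16 n3; set KX := K * _; set tk := t * K; lia.
Qed.

(** * The degeneracy theorem *)

(** Induction on the number of vertices. Once no vertex of degree 2 is left, each edge weighs at
    most [q], so a cycle of weight above [m * q] has more than [m] edges. The bound [3 <= m] rules
    out triangles at each suppression. *)
Lemma suppress_all (T : finType) (S : {set T}) (e : rel T) w m q :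
  wgraph S e w (m * q) q -> 3 <= m -> S != set0 ->
  exists S' e' B, [/\ S' != set0 /\ model S' e' S e B,
    symmetric e' /\ irreflexive e',
    forall x y, e' x y -> x \in S',
    forall x, x \in S' -> 2 < #|nbr e' x|
  & girth_above e' m].
Proof.
move=> W m3; move: {2}#|S| (leqnn #|S|) => n; elim: n S e w W => [|n IHn] S e w W.
  by rewrite leqn0 cards_eq0 => ->.
move=> Sn S0; have [esi eS degS cyc ear] := W.
have [/exists_inP[v vS /eqP nv2]|] := boolP [exists v in S, #|nbr e v| == 2]; last first.
  rewrite negb_exists_in => /forall_inP deg3; exists S, e, set1; split=> //.
  - by split=> //; exact: model_id.
  - by move=> x xS; rewrite ltn_neqAle degS // andbT eq_sym; exact: deg3.
  move=> x p up xl sp; have := cyc x p up xl sp.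
  have irr := esi.2.
  have eq1 y z : e y z -> w y z <= q.
    move=> yz; have := ear y [:: z]; rewrite /= addn0; apply.
      rewrite /upath /= yz inE /= andbT.
      by apply: contraTneq yz => ->; rewrite irr.
    by move=> z'; rewrite inE => ->.
  have wtq : wt w x p <= size p * q.
    have /andP[xp _] := up; elim: (p) (x) xp => [|y s IHs] z //= /andP[zy ys].
    by rewrite mulSn leq_add ?eq1 ?IHs.
  move=> H; have : m * q < (size p).+1 * q.
    by apply: leq_trans H _; rewrite mulSn addnC leq_add ?eq1.
  by rewrite ltn_mul2r => /andP[].
have /cards2P[a [b [nab nv]]] : #|nbr e v| == 2 by rewrite nv2.
have W' := sup_wgraph W (leq_mul m3 (leqnn q)) nv nab.
have [B MB] := sup_model W nv nab.
have va : a \in S :\ v.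
  have va : e v a by have := set21 a b; rewrite -nv inE.
  rewrite !inE (eS a v) ?andbT; last by rewrite esi.1.
  by apply: contraTneq va => ->; rewrite esi.2.
have [||S' [e' [B' [[S'0 M'] ? ? ? ?]]]] := IHn _ _ _ W'.
- by move: Sn; rewrite (cardsD1 v S) vS.
- by apply/set0Pn; exists a.
exists S', e', (fun u => \bigcup_(x in B' u) B x); split=> //.
by split=> //; exact: model_comp MB M'.
Qed.

(** * Average degrees of minors *)

Section GraphOn.

Variables (T : finType) (X : {set T}) (f : rel T).
Hypotheses (f_sym : symmetric f) (f_irr : irreflexive f).

Definition adj_on : rel 'I_#|X| := fun i j => f (enum_val i) (enum_val j).

Lemma adj_on_sym : symmetric adj_on. Proof. by move=> i j; exact: f_sym. Qed.
Lemma adj_on_irr : irreflexive adj_on. Proof. by move=> i; exact: f_irr. Qed.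

Definition graph_on := SGraph adj_on_sym adj_on_irr.

Lemma graph_on_deg : \sum_(i < #|X|) #|[set j | adj_on i j]| =
  \sum_(x in X) #|[set y in X | f x y]|.
Proof.
rewrite [RHS]big_enum_val; apply: eq_bigr => i _.
rewrite -(card_imset _ (@enum_val_inj _ (mem X))); apply: eq_card => y.
apply/imsetP/idP=> [[j + ->]|]; rewrite !inE; first by rewrite enum_valP.
case/andP=> yX iy; exists (enum_rank_in yX y); last by rewrite enum_rankK_in.
by rewrite inE /adj_on enum_rankK_in.
Qed.

End GraphOn.

Lemma minor_graph_on (G : sgraph) (X S : {set 'I_(nv G)}) f B
  (f_sym : symmetric f) (f_irr : irreflexive f) :
  model X f S (adj G) B -> minor (graph_on X f_sym f_irr) G.
Proof.
case=> n0 _ dis con edg; exists (fun i : 'I_#|X| => B (enum_val i)); split.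
- by move=> i; apply: n0; exact: enum_valP.
- move=> i j ij; apply: dis; try exact: enum_valP.
  by apply: contraNneq ij => /enum_val_inj ->.
- by move=> i; apply: con; exact: enum_valP.
- by move=> i j ij; apply: edg; try exact: enum_valP.
Qed.

Lemma big_Rmax_ge (I : eqType) (r : seq I) (P : pred I) (F : I -> R) i :
  i \in r -> P i -> (F i <= \big[Rmax/0%R]_(j <- r | P j) F j)%R.
Proof.
move=> ir Pi; elim: r ir => [|j r IHr] //; rewrite inE big_cons => /orP[/eqP<-|ir].
  by rewrite Pi; exact: Rmax_l.
case: ifP => _; last exact: IHr.
by apply: Rle_trans (IHr ir) _; exact: Rmax_r.
Qed.

(** An edge is the image of at most two ordered pairs. *)
Lemma edges_in_card (G : sgraph) (S : {set 'I_(nv G)}) :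
  \sum_(x in S) deg_in S x <= 2 * #|edges_in S|.
Proof.
rewrite /edges_in; set P := [set x | _].
have -> : \sum_(x in S) deg_in S x = #|P|.
  rewrite -sum1dep_card (eq_bigl (fun z => (z.1 \in S) && ((z.2 \in S) && adj G z.1 z.2))) //.
  rewrite -(pair_big_dep (mem S) (fun x y => (y \in S) && adj G x y) (fun _ _ => 1)) /=.
  by apply: eq_bigr => x _; rewrite sum1dep_card.
rewrite -sum1_card (partition_big_imset (fun x => [set x.1; x.2])) /=.
rewrite mulnC -sum_nat_const; apply: leq_sum => E /imsetP[[a b] abP ->] /=.
rewrite sum1dep_card; apply: (@leq_trans #|[set (a, b); (b, a)]|).
  apply: subset_leq_card; apply/subsetP=> -[c d]; rewrite !inE /=.
  case/andP=> /and3P[_ _ cd] /eqP/setP E'.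
  have ncd : c != d by apply: contraTneq cd => ->; rewrite adj_irr.
  have := E' c; have := E' d; rewrite !inE !eqxx orbT /= => /esym dab /esym cab.
  rewrite !xpair_eqE; case/orP: cab ncd => /eqP->; case/orP: dab => /eqP->;
    by rewrite ?eqxx ?orbT.
by rewrite cards2; case: (_ != _).
Qed.

Lemma mad_ge (G : sgraph) (S : {set 'I_(nv G)}) : S != set0 ->
  (INR (\sum_(x in S) deg_in S x) / INR #|S| <= mad G)%R.
Proof.
move=> S0; apply: Rle_trans (big_Rmax_ge _ (mem_index_enum S) S0).
apply: Rmult_le_compat_r.
  by apply/Rlt_le/Rinv_0_lt_compat/lt_0_INR/ltP; rewrite card_gt0.
have := le_INR _ _ (elimT leP (edges_in_card S)); rewrite mult_INR /=; lra.
Qed.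

Lemma mad_graph_on (T : finType) (X : {set T}) (f : rel T)
    (f_sym : symmetric f) (f_irr : irreflexive f) : X != set0 ->
  (INR (\sum_(x in X) #|[set y in X | f x y]|) <= mad (graph_on X f_sym f_irr) * INR #|X|)%R.
Proof.
move=> X0; have X0' : 0 < #|X| by rewrite card_gt0.
have c0 : (0 < INR #|X|)%R by apply/lt_0_INR/ltP.
have S0 : [set: 'I_(nv (graph_on X f_sym f_irr))] != set0.
  by apply/set0Pn; exists (Ordinal X0'); rewrite inE.
have := mad_ge S0; rewrite cardsT card_ord /= => H.
apply: (Rmult_le_reg_r (/ INR #|X|)); first exact: Rinv_0_lt_compat.
rewrite Rmult_assoc Rinv_r ?Rmult_1_r; last lra.
apply: Rle_trans H; apply: Rmult_le_compat_r; first exact/Rlt_le/Rinv_0_lt_compat.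
right; congr INR; rewrite -graph_on_deg; apply: eq_big => [i|i _]; first by rewrite inE.
by apply: eq_card => j; rewrite !inE.
Qed.

(** * Numerical thresholds *)

Lemma nat_floor x : (0 <= x)%R -> exists n, (INR n <= x < INR n + 1)%R.
Proof.
move=> x0; have [h1 h2] := base_Int_part x.
have z0 : (0 <= Int_part x)%Z.
  have H : (IZR (-1) < IZR (Int_part x))%R by rewrite /=; lra.
  by have := lt_IZR _ _ H; lia.
exists (Z.to_nat (Int_part x)); rewrite INR_IZR_INZ Z2Nat.id //; lra.
Qed.

Lemma ln_lt_pow x y n m : (0 < x)%R -> (0 < y)%R ->
  (INR n * ln x < INR m * ln y)%R -> (x ^ n < y ^ m)%R.
Proof.
by move=> x0 y0; rewrite -!ln_pow //; apply: ln_lt_inv; apply: pow_lt.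
Qed.

(** The two cases are the two values of the minimum; since [576 = 24 ^ 2], the second one collects
    into a fourth power. *)
Lemma log2_threshold d k : (1 <= d)%R ->
  (4 * log2 d + 2 * log2 (Rmin d 576) < INR (4 * k + 3))%R ->
  (d ^ 6 < 2 ^ (4 * k + 3))%R \/ ((24 * d) ^ 4 < 2 ^ (4 * k + 3))%R.
Proof.
move=> d1; rewrite /log2; have l2 : (0 < ln 2)%R by have := ln_lt_2; lra.
move=> H; have {}H : (4 * ln d + 2 * ln (Rmin d 576) < INR (4 * k + 3) * ln 2)%R.
  have := Rmult_lt_compat_r _ _ _ l2 H.
  have -> : ((4 * (ln d / ln 2) + 2 * (ln (Rmin d 576) / ln 2)) * ln 2 =
    4 * ln d + 2 * ln (Rmin d 576))%R by field; lra.
  by [].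
move: H; rewrite /Rmin; case: Rle_dec => d576 H; [left|right].
  by apply: ln_lt_pow; [lra|lra|move: H; rewrite /=; lra].
apply: ln_lt_pow; [lra|lra|].
have e : ln 576 = (2 * ln 24)%R.
  have -> : 576%R = (24 ^ 2)%R by lra.
  by rewrite ln_pow /=; lra.
by move: H; rewrite e ln_mult /=; lra.
Qed.

(** The right-hand sides are at most [2 ^ 7 = 128], below both [3 ^ 6] and [72 ^ 4]. *)
Lemma threshold_small d k : (1 <= d)%R -> k <= 1 ->
  (d ^ 6 < 2 ^ (4 * k + 3))%R \/ ((24 * d) ^ 4 < 2 ^ (4 * k + 3))%R -> (d < 3)%R.
Proof.
move=> d1 k1 H; case: (Rlt_le_dec d 3) => // d3.
have b : (2 ^ (4 * k + 3) <= 2 ^ 7)%R by apply: Rle_pow; [lra|apply/leP; lia].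
case: H => H.
  have h : (0 <= 3 <= d)%R by lra.
  have := pow_incr _ _ 6 h; lra.
have h : (0 <= 72 <= 24 * d)%R by lra.
have := pow_incr _ _ 4 h; lra.
Qed.

(** Otherwise [d >= 2 + 15 K / 32] with [K = 2 ^ k], and either power exceeds
    [2 ^ (4 * k + 3) = 8 K ^ 4]. *)
Lemma threshold_large d k : (1 <= d)%R -> 2 <= k ->
  (d ^ 6 < 2 ^ (4 * k + 3))%R \/ ((24 * d) ^ 4 < 2 ^ (4 * k + 3))%R ->
  (32 * d < 64 + 15 * 2 ^ k)%R.
Proof.
move=> d1 k2 H; case: (Rlt_le_dec (32 * d) (64 + 15 * 2 ^ k)) => // dk.
have KE : (2 ^ (4 * k + 3) = 8 * (2 ^ k) ^ 4)%R.
  by rewrite mulnC pow_add pow_mult; lra.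
rewrite KE in H; clear KE.
have K0 : (0 < 2 ^ k)%R by apply: pow_lt; lra.
have dK : (2 + 15 / 32 * 2 ^ k <= d)%R by lra.
case: H => H; last first.
  have h : (0 <= 24 * (15 / 32 * 2 ^ k) <= 24 * d)%R by lra.
  have {h} := pow_incr _ _ 4 h; rewrite !Rpow_mult_distr => h.
  have : (0 < (2 ^ k) ^ 4)%R by apply: pow_lt.
  rewrite !Rpow_mult_distr in H; lra.
have {dK} h : (0 <= 2 + 15 / 32 * 2 ^ k <= d)%R by lra.
have {h} dK := pow_incr _ _ 6 h.
case: k k2 H dK K0 {dk} => [|[|[|[|[|k]]]]] // _ H dK K0; [lra|lra|lra|].
have K32 : (32 <= 2 ^ k.+4.+1)%R.
  have -> : 32%R = (2 ^ 5)%R by lra.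
  by apply: Rle_pow; [lra|apply/leP; lia].
move: (2 ^ k.+4.+1)%R K32 K0 H dK => K K32 K0 H dK.
have h1 : ((15 / 32 * K) ^ 6 <= (2 + 15 / 32 * K) ^ 6)%R by apply: pow_incr; lra.
have h2 : (15 ^ 2 <= (15 / 32 * K) ^ 2)%R by apply: pow_incr; lra.
have h3 : (0 < K ^ 4)%R by apply: pow_lt.
have e6 : ((15 / 32 * K) ^ 6 = (15 / 32 * K) ^ 2 * ((15 / 32) ^ 4 * K ^ 4))%R by ring.
have h4 : (0 < (15 / 32) ^ 4 * K ^ 4)%R by apply: Rmult_lt_0_compat => //; lra.
have h5 := Rmult_le_compat_r _ _ _ (Rlt_le _ _ h4) h2.
lra.
Qed.

(** * Irreducible subgraphs and the conclusion *)

Lemma reducible_all (G : sgraph) p :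
  (forall S : {set 'I_(nv G)}, S != set0 -> exists2 S', p_reduction p S S' & #|S'| < #|S|) ->
  forall S : {set 'I_(nv G)}, reducible p S.
Proof.
move=> red S; move: {2}#|S| (leqnn #|S|) => n; elim: n S => [|n IHn] S.
  by rewrite leqn0 cards_eq0 => /eqP->; exact: reducible_empty.
move=> Sn; have [->|S0] := eqVneq S set0; first exact: reducible_empty.
have [S' SS' lS] := red S S0; apply: reducible_step SS' _; apply: IHn.
by rewrite -ltnS; exact: leq_trans lS Sn.
Qed.

(** With unit weights, weight is length: no deletable vertex means minimum degree 2, no deletable
    ear means ears of length at most [p - 1]. *)
Lemma irreducible_wgraph (G : sgraph) (S : {set 'I_(nv G)}) p m : 2 <= p ->
  (forall s, @is_cycle G s -> m * p.-1 < size s) ->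
  ~ (exists2 S', p_reduction p S S' & #|S'| < #|S|) ->
  wgraph S (restr (adj G) S) (fun _ _ => 1) (m * p.-1) p.-1.
Proof.
move=> p2 gm nred; set e := restr _ S.
have sub : subrel e (adj G) by move=> x y /and3P[].
have wtE x s : wt (fun _ _ => 1) x s = size s.
  by elim: s x => //= y s IHs x; rewrite IHs add1n.
have degE x : x \in S -> nbr e x = [set y in S | adj G x y].
  by move=> xS; apply/setP=> y; rewrite !inE /e /restr xS.
have inS x s : s != [::] -> path e x s -> all (fun z => z \in S) (x :: s).
  elim: s x => [|y s IHs] x //= _ /andP[/and3P[xS yS _] ys]; rewrite xS yS /=.
  by case: s IHs ys => [|z s] //= IHs ys; have /andP[] := IHs y isT ys.
split.
- split=> [x y|x]; first by rewrite /e /restr adj_sym andbCA.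
  by rewrite /e /restr adj_irr !andbF.
- by move=> x y /and3P[].
- move=> x xS; rewrite ltnNge; apply/negP=> dx; case: nred; exists (S :\ x).
    by left; exists x; split=> //; rewrite /deg_in -degE.
  by rewrite [X in _ < X](cardsD1 x) xS.
- move=> x s /andP[xs us] sx s1; rewrite wtE addn1.
  apply: (gm (x :: s)); rewrite /is_cycle us /= !ltnS s1 rcons_path.
  by rewrite (sub_path sub xs) sub.
- move=> x s /andP[xs us] deg2; rewrite wtE leqNgt; apply/negP=> ps; apply: nred.
  case/lastP: s => [|mid y] in xs us deg2 ps *; first by move: ps.
  rewrite size_rcons in ps; rewrite last_rcons in deg2.
  have aS : all (fun z => z \in S) (x :: rcons mid y) by apply: inS xs; case: (mid).
  have midS z : z \in mid -> z \in S.
    by move=> zm; apply: (allP aS); rewrite inE mem_rcons inE zm !orbT.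
  have ym : y \notin mid by move: us => /= /andP[_]; rewrite rcons_uniq => /andP[].
  exists (S :\: [set z in mid]).
    right; exists x, mid, y; split=> //; last by rewrite addn1; case: (p) ps.
    rewrite /strict_ear aS us (sub_path sub xs) /=; apply/allP=> z zm.
    rewrite /deg_in -degE ?midS // deg2 //; first by rewrite mem_rcons inE zm orbT.
    by apply: contraNneq ym => <-.
  (* As [p >= 2], the ear has an internal vertex and its removal shrinks [S]. *)
  case: mid ps midS {xs us deg2 aS ym} => [|z mid] ps midS; first by case: (p) p2 ps => [|[]].
  apply: proper_card; apply/properP; split; first exact: subsetDl.
  by exists z; [apply: midS|]; rewrite !inE eqxx.
Qed.

Theorem mainTheorem4 (C : gclass) (d : R) :
  minor_closed C -> proper_class C -> (exists G, C G /\ has_edge G) ->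
  is_mad_class C d ->
  forall p : nat, 2 <= p ->
  forall G : sgraph, C G ->
    girth_gt G ((4 * log2 d + 2 * log2 (Rmin d 576) + 3) * INR (p - 1))%R ->
    path_degenerate p G.
Proof.
move=> minC _ [G0 [CG0 [u [v uv]]]] [ub _] p p2 G CG gG.
have madC H : C H -> (mad H <= d)%R by move=> CH; apply: ub; exists H.
have nuv : u != v by apply: contraTneq uv => ->; rewrite adj_irr.
have d1 : (1 <= d)%R.
  have uv0 : [set u; v] != set0 by apply/set0Pn; exists u; rewrite set21.
  apply: Rle_trans (madC _ CG0); apply: Rle_trans (mad_ge uv0).
  rewrite cards2 nuv big_setU1 ?inE //= big_set1.
  have du : 0 < deg_in [set u; v] u.
    by apply/card_gt0P; exists v; rewrite !inE eqxx orbT.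
  have dv : 0 < deg_in [set u; v] v.
    by apply/card_gt0P; exists u; rewrite !inE eqxx /= adj_sym.
  have H : 2 <= deg_in [set u; v] u + deg_in [set u; v] v by lia.
  by have := le_INR _ _ (elimT leP H); rewrite /=; lra.
set g := (4 * _ + _ + 3)%R in gG.
have g3 : (3 <= g)%R.
  have l x : (1 <= x)%R -> (0 <= log2 x)%R.
    move=> x1; apply: Rmult_le_pos; last by apply/Rlt_le/Rinv_0_lt_compat; have := ln_lt_2; lra.
    by case: x1 => [x1|<-]; [have := ln_increasing 1 x _ x1; rewrite ln_1; lra|rewrite ln_1; lra].
  have := l d d1; have : (1 <= Rmin d 576)%R by apply: Rmin_glb; lra.
  move/l; rewrite /g; lra.
(* This is [4 k + 2 <= g < 4 k + 6]. *)
have [k [k1 k2]] : exists k, (INR k <= (g - 2) / 4 < INR k + 1)%R by apply: nat_floor; lra.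
have thr : (d ^ 6 < 2 ^ (4 * k + 3))%R \/ ((24 * d) ^ 4 < 2 ^ (4 * k + 3))%R.
  apply: log2_threshold => //; rewrite plus_INR mult_INR; move: k2; rewrite /g /=; lra.
(* Suppression requires [m >= 3], which [4 k + 2] misses at [k = 0]; [g >= 3] permits the larger
   value. *)
pose m := maxn 3 (4 * k + 2).
have mg : (INR m <= g)%R.
  rewrite /m /maxn; case: ifP => _; last by rewrite /=; lra.
  by rewrite plus_INR mult_INR /=; lra.
have cyc s : @is_cycle G s -> m * p.-1 < size s.
  move=> /gG; rewrite subn1 => H; apply/ltP; apply: INR_lt; rewrite mult_INR.
  by apply: Rle_lt_trans H; apply: Rmult_le_compat_r => //; exact: pos_INR.
apply: reducible_all => S S0; apply: NNPP => nred.
have W := irreducible_wgraph p2 cyc nred.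
have [S1 [e1 [B1 [[S10 M1] [sym1 irr1] sup1 deg1 gir1]]]] := suppress_all W (leq_maxl _ _) S0.
have MG : model S (restr (adj G) S) setT (adj G) set1.
  have [n s dj c h] := model_id (adj G) S; split=> // x y xS yS xy.
  by apply: h => //; case/and3P: xy.
have {}M1 := model_comp MG M1.
have [k_le1|k_gt1] := leqP k 1.
  have := madC _ (minC _ _ CG (minor_graph_on sym1 irr1 M1)).
  have := mad_graph_on sym1 irr1 S10; set a := mad _.
  have H : 3 * #|S1| <= \sum_(x in S1) #|[set y in S1 | e1 x y]|.
    rewrite mulnC -sum_nat_const; apply: leq_sum => x /deg1 dx; apply: leq_trans dx _.
    apply: subset_leq_card; apply/subsetP=> y; rewrite !inE => xy; rewrite xy andbT.
    by apply: (sup1 y x); rewrite sym1.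
  have := le_INR _ _ (elimT leP H); rewrite mult_INR.
  have c0 : (0 < INR #|S1|)%R by apply/lt_0_INR/ltP; rewrite card_gt0.
  have := threshold_small d1 k_le1 thr; have -> : INR 3 = 3%R by rewrite /=; lra.
  by nra.
have gk : girth_above e1 (4 * k + 2).
  by move=> x s us ls s1; apply: leq_trans (gir1 x s us ls s1); exact: leq_maxr.
have [Y [YS Y0 HY]] := dense_cells sym1 irr1 sup1 gk deg1 S10 k_gt1.
have M2 := model_comp M1 (vor_model sym1 k sup1 YS).
have := madC _ (minC _ _ CG (minor_graph_on (vadj_sym Y sym1 k) (vadj_irr e1 Y k) M2)).
have := mad_graph_on (vadj_sym Y sym1 k) (vadj_irr e1 Y k) Y0; set a := mad _.
have := le_INR _ _ (elimT leP HY); rewrite !mult_INR plus_INR mult_INR INR_expn.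
have c0 : (0 < INR #|Y|)%R by apply/lt_0_INR/ltP; rewrite card_gt0.
have := threshold_large d1 k_gt1 thr.
have -> : INR 64 = 64%R by rewrite /=; lra.
have -> : INR 15 = 15%R by rewrite /=; lra.
have -> : INR 32 = 32%R by rewrite /=; lra.
have -> : INR 2 = 2%R by rewrite /=; lra.
by nra.
Qed.
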